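(* For any integer $k\ge0$, the span $\mathcal{H}^k_n=\mathrm{span}\{h^k_1,\ldots,h^k_n\}$ of the $k$th degree falling factorial basis functions satisfies $$\mathcal{H}^k_n=\mathcal{DS}^k_n(x_{(k+1):(n-1)},[a,b]),$$ the space of $k$th degree discrete splines on $[a,b]$ with knots $x_{(k+1):(n-1)}=\{x_{k+1},\ldots,x_{n-1}\}$.
   Context: Design points: $a\le x_1<\cdots<x_n\le b$ with $n\ge k+1$, and $x_{n+1}=b$. ''Degree $k$ polynomial'' means degree at most $k$. Empty products equal 1. Divided differences: $f[z]=f(z)$ and $f[z_1,\ldots,z_{r+1}]=(f[z_2,\ldots,z_{r+1}]-f[z_1,\ldots,z_r])/(z_{r+1}-z_1)$ for distinct points. Discrete derivatives: $\Delta^0_n=\mathrm{Id}$ and, for $\ell\ge1$, $(\Delta^\ell_nf)(x)=\ell!\,f[x_{i-\ell+1},\ldots,x_i,x]$ if $x\in(x_i,x_{i+1}]$, $i\ge \ell$; $(\Delta^\ell_nf)(x)=i!\,f[x_1,\ldots,x_i,x]$ if $x\in(x_i,x_{i+1}]$, $1\le i<\ell$; $(\Delta^\ell_nf)(x)=f(x)$ if $x\le x_1$. Falling factorial basis (functions on $[a,b]$): $h^k_j(x)=\frac1{(j-1)!}\prod_{\ell=1}^{j-1}(x-x_\ell)$ for $j=1,\ldots,k+1$, and $h^k_j(x)=\frac1{k!}\prod_{\ell=j-k}^{j-1}(x-x_\ell)\cdot1\{x>x_{j-1}\}$ for $j=k+2,\ldots,n$. Discrete splines: for knots $a=t_0\le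 t_1<\cdots<t_r<t_{r+1}=b$ with $t_{1:r}\subseteq x_{1:n}$ and $t_1\ge x_{k+1}$, let $I_0=[t_0,t_1]$ and $I_i=(t_i,t_{i+1}]$, $i=1,\ldots,r$. The space $\mathcal{DS}^k_n(t_{1:r},[a,b])$ consists of all functions $f$ on $[a,b]$ such that: for each $i=0,\ldots,r$ there is a $k$th degree polynomial $p_i$ with $f|_{I_i}=p_i|_{I_i}$; and for each $i=1,\ldots,r$, $(\Delta^\ell_np_{i-1})(t_i)=(\Delta^\ell_np_i)(t_i)$ for $\ell=0,\ldots,k-1$. *)

(* Defs.v *)
From HB Require Import structures.
From mathcomp Require Import all_boot all_order all_algebra.
From mathcomp Require Import boolp classical_sets functions reals.

Set Implicit Arguments.
Unset Strict Implicit.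
Unset Printing Implicit Defensive.

Import Order.TTheory GRing.Theory Num.Theory.
Local Open Scope classical_set_scope.
Local Open Scope ring_scope.

(* Design points x, basis functions h and knots t are maps from nat numbered
   from 1, as in x_1, ..., x_n; their value at 0 is never used. *)

Definition design_points (R : realType) (n : nat) (a b : R) (x : nat -> R) : Prop :=
  [/\ a <= x 1%N, forall i, (1 <= i < n)%N -> x i < x i.+1, x n <= b
    & x n.+1 = b].

(* The interval [a, b] as a type, so that two functions on it are equal when
   they agree on [a, b]. *)
Definition dom (R : realType) (a b : R) : Type := {z : R | z \in `[a, b]}.

(* divdiff f r z is f[z 0, ..., z r]. *)
Fixpoint divdiff (R : realType) (f : R -> R) (r : nat) (z : nat -> R) : R :=
  if r is r'.+1 then
    (divdiff f r' (fun i => z i.+1) - divdiff f r' z) / (z r - z 0%N)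
  else f (z 0%N).

(* f[x_m, ..., x_(m + r - 1), z] *)
Definition divdiff_design (R : realType) (f : R -> R) (x : nat -> R)
    (m r : nat) (z : R) : R :=
  divdiff f r (fun i => if (i < r)%N then x (m + i)%N else z).

(* The l-th discrete derivative at z. At z in [a, b] only the values of f at z
   and at design points matter, so f is simply given on all of R. For design
   points, at most one i in 1..n satisfies x_i < z <= x_(i+1), and for z in
   [a, b] there is none exactly when z <= x_1. *)
Definition discrete_deriv (R : realType) (n : nat) (x : nat -> R) (l : nat)
    (f : R -> R) (z : R) : R :=
  if l == 0%N then f z
  else if [pick i : 'I_n.+1 | (1 <= i)%N && (x i < z <= x i.+1)] is Some i then
    if (l <= i)%N then l`!%:R * divdiff_design f x (i - l).+1 l z
    else i`!%:R * divdiff_design f x 1 i z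
  else f z.

Definition ff_basis (R : realType) (k : nat) (a b : R) (x : nat -> R)
    (j : nat) (z : dom a b) : R :=
  if (j <= k.+1)%N then
    (j.-1)`!%:R^-1 * \prod_(1 <= l < j) (val z - x l)
  else
    k`!%:R^-1 * \prod_(j - k <= l < j) (val z - x l) * (x j.-1 < val z)%R%:R.

Definition span_family (R : realType) (V : lmodType R) (n : nat)
    (h : nat -> V) : set V :=
  [set v | exists c : nat -> R, v = \sum_(1 <= j < n.+1) c j *: h j].

Definition falling_factorial_space (R : realType) (k n : nat) (a b : R)
    (x : nat -> R) : set (dom a b -> R) :=
  @span_family R (dom a b -> R^o) n (fun j => ff_basis k x j).
Arguments falling_factorial_space {R} k n a b x.

(* t_1, ..., t_r extended by t_0 = a and t_(r+1) = b *)
Definition knot (R : realType) (a b : R) (r : nat) (t : nat -> R) (i : nat) : R :=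
  if i == 0%N then a else if i == r.+1 then b else t i.

Definition knot_interval (R : realType) (a b : R) (r : nat) (t : nat -> R)
    (i : nat) : interval R :=
  if i == 0%N then `[knot a b r t 0, knot a b r t 1]
  else `]knot a b r t i, knot a b r t i.+1].

(* The space DS^k_n(t_(1:r), [a, b]), for knots that are admissible_knots. *)
Definition discrete_splines (R : realType) (k n : nat) (a b : R) (x : nat -> R)
    (r : nat) (t : nat -> R) : set (dom a b -> R) :=
  [set f | exists p : nat -> {poly R},
    [/\ forall i, (i <= r)%N -> (size (p i) <= k.+1)%N,
        forall i, (i <= r)%N -> forall z : dom a b,
          val z \in knot_interval a b r t i -> f z = (p i).[val z]
      & forall i, (1 <= i <= r)%N -> forall l, (l < k)%N ->
          discrete_deriv n x l (horner (p i.-1)) (t i) =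
          discrete_deriv n x l (horner (p i)) (t i)]].
Arguments discrete_splines {R} k n a b x r t.

Definition admissible_knots (R : realType) (k n : nat) (a b : R) (x : nat -> R)
    (r : nat) (t : nat -> R) : Prop :=
  [/\ a <= knot a b r t 1,
      forall i, (1 <= i <= r)%N -> knot a b r t i < knot a b r t i.+1,
      forall i, (1 <= i <= r)%N -> exists2 j, (1 <= j <= n)%N & t i = x j
    & x k.+1 <= knot a b r t 1].

Lemma design_points_mono (R : realType) (n : nat) (a b : R) (x : nat -> R) :
  design_points n a b x ->
  forall i j, (1 <= i)%N -> (i <= j)%N -> (j <= n)%N -> x i <= x j.
Proof.
case=> _ xlt _ _ i j i1; elim: j => [|j IH]; first by case: i i1.
rewrite leq_eqVlt => /orP[/eqP-> //|ij] jn.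
apply: le_trans (IH ij (ltnW jn)) _.
by apply/ltW/xlt; rewrite (leq_trans i1 ij) jn.
Qed.

Lemma admissible_design_knots (R : realType) (k n : nat) (a b : R)
    (x : nat -> R) :
  (k.+1 <= n)%N -> design_points n a b x ->
  admissible_knots k n a b x (n - k.+1) (fun i => x (k + i)%N).
Proof.
move=> kn hx; have mono := design_points_mono hx.
have [ax1 xlt xnb _] := hx.
have ub i : (1 <= i <= n)%N -> x i <= b.
  by case/andP=> i1 ni; apply: le_trans (mono i n i1 ni _) xnb.
have lb i : (1 <= i <= n)%N -> a <= x i.
  by case/andP=> i1 ni; apply: le_trans ax1 (mono 1%N i _ i1 ni).
have kn' : (1 <= k.+1 <= n)%N by [].
have n1 : (1 <= n)%N by apply: leq_ltn_trans kn.
split.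
- rewrite /knot /=; case: ifP => _; last by rewrite addn1 lb.
  exact: le_trans (lb _ kn') (ub _ kn').
- move=> i /andP[i1 ir].
  have kin : (k + i < n)%N.
    by rewrite -(subnKC kn) addSn ltnS leq_add2l.
  have ki1 : (1 <= k + i)%N by rewrite addn_gt0 i1 orbT.
  have step : x (k + i)%N < x (k + i).+1 by apply: xlt; rewrite ki1 kin.
  rewrite /knot eqn0Ngt i1 /= (ltn_eqF (_ : i < (n - k.+1).+1)%N) //.
  case: ifP => _; last by rewrite addnS.
  by apply: lt_le_trans step (ub _ _).
- move=> i /andP[i1 ir]; exists (k + i)%N => //.
  rewrite addn_gt0 i1 orbT /= -(subnKC kn) addSn.
  by apply: leqW; rewrite leq_add2l.
- by rewrite /knot /=; case: ifP => _; [apply: ub | rewrite addn1].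
Qed.

(* Main.v *)
Require Import Defs.
From mathcomp Require Import all_boot all_order all_algebra.
From mathcomp Require Import boolp classical_sets functions reals.
From mathcomp Require Import zify.

(** Write h_j for the falling factorial basis functions, P_j for the polynomial
    from which h_j is cut out ([ff_poly]) and I_i, 0 <= i <= r = n - k - 1, for
    the intervals between consecutive knots x_(k+1), ..., x_(n-1).

    On I_i the functions h_j with j <= k + i + 1 coincide with P_j and the
    others vanish ([ff_basis_piece]).  Hence f = sum_j c_j h_j if and only if
    the piece of f on every I_i is the partial sum
    p_i = sum_(j <= k + i + 1) c_j P_j.  Crossing one knot adds one term: p_i
    and p_(i-1) differ by c_(k+i+1) P_(k+i+1), and P_(k+i+1) is, up to a
    constant, the polynomial of degree k that vanishes at the k consecutive
    design points x_(i+1), ..., x_(i+k).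

    On the spline side, the discrete derivative of order l at a design point
    x_m is a multiple of the divided difference over x_(m-l), ..., x_m.  The
    divided difference over a window determines the value at its first point
    once the other values are known ([divdiff_head]), so by induction on l two
    functions have the same derivatives of order l < k at x_m exactly when they
    agree at the k points x_m, x_(m-1), ..., x_(m-k+1)
    ([discrete_deriv_agree]).  For m = k + i this says that p_i - p_(i-1)
    vanishes at x_(i+1), ..., x_(i+k), i.e. that it is a multiple of
    P_(k+i+1).  As p_0 is an arbitrary polynomial of degree at most k, and
    P_1, ..., P_(k+1) have degrees 0, ..., k, the sequences of pieces of
    discrete splines are exactly the sequences of partial sums
    ([ff_partial_sums]). *)

Set Implicit Arguments.
Unset Strict Implicit.
Unset Printing Implicit Defensive.

Import Order.TTheory GRing.Theory Num.Theory.
Local Open Scope ring_scope.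

(** * Divided differences and discrete derivatives at design points *)

Lemma eq_divdiff (R : realType) (f g : R -> R) (r : nat) (w : nat -> R) :
  (forall i, (i <= r)%N -> f (w i) = g (w i)) -> divdiff f r w = divdiff g r w.
Proof.
elim: r w => [|r IH] w fg /=; first exact: fg.
rewrite (IH (fun i => w i.+1)) => [|i ir]; last exact: fg.
by rewrite (IH w) => // i ir; apply/fg/leqW.
Qed.

Lemma eq_divdiff_points (R : realType) (f : R -> R) (r : nat) (w w' : nat -> R) :
  (forall i, (i <= r)%N -> w i = w' i) -> divdiff f r w = divdiff f r w'.
Proof.
elim: r w w' => [|r IH] w w' ww' /=; first by rewrite ww'.
rewrite (IH _ (fun i => w' i.+1)) => [|i ir]; last exact: ww'.
by rewrite (IH w w') ?ww' // => i ir; apply/ww'/leqW.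
Qed.

(** In the recursion for [divdiff f r.+1 w] the point [w 0] enters only through
    the shorter window [w 0, ..., w r], so that window's divided difference
    can be solved for, down to [f (w 0)] itself. *)
Lemma divdiff_head (R : realType) (f g : R -> R) (r : nat) (w : nat -> R) :
  (forall i, (1 <= i <= r)%N -> w i != w 0%N) ->
  (forall i, (1 <= i <= r)%N -> f (w i) = g (w i)) ->
  divdiff f r w = divdiff g r w -> f (w 0%N) = g (w 0%N).
Proof.
elim: r => [//|r IH] wne fg /=.
have w0 : w r.+1 - w 0%N != 0 by rewrite subr_eq0 wne /=.
move/(mulIf (invr_neq0 w0)).
rewrite (@eq_divdiff R f g r (fun i => w i.+1)) => [|i ir]; last exact: fg.
move/addrI/oppr_inj; apply: IH => i /andP[i1 ir].
  by apply: wne; rewrite i1 leqW.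
by apply: fg; rewrite i1 leqW.
Qed.

Lemma design_points_lt (R : realType) (n : nat) (a b : R) (x : nat -> R) :
  design_points n a b x ->
  forall i j, (1 <= i)%N -> (i < j)%N -> (j <= n)%N -> x i < x j.
Proof.
move=> hx i j i1 ij jn; have [_ xlt _ _] := hx.
apply: lt_le_trans (xlt i _) (design_points_mono hx _ ij jn) => //.
by rewrite i1 (leq_trans ij).
Qed.

(** For [l >= 1], hence [m >= 2], the point [x m] is the right end of its cell
    between [x m.-1] and [x m], so the derivative there is taken over the
    [l + 1] consecutive design points ending at [x m]. *)
Lemma discrete_deriv_design (R : realType) (n : nat) (a b : R) (x : nat -> R)
    (m l : nat) (f : R -> R) :
  design_points n a b x -> (l < m)%N -> (m <= n)%N ->
  discrete_deriv n x l f (x m) =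
  l`!%:R * divdiff f l (fun i => x (m - l + i)%N).
Proof.
move=> hx lm mn; have mono := design_points_mono hx.
rewrite /discrete_deriv; case: eqVneq => [->|l0].
  by rewrite mul1r /= subn0 addn0.
case: m => // m in lm mn *; have m1 : (1 <= m)%N by lia.
case: pickP => [i /and3P[i1 xim xmi]|/(_ (Ordinal (leqW mn)))]; last first.
  by rewrite /= m1 lexx andbT (design_points_lt hx).
have -> : nat_of_ord i = m.
  apply/eqP; rewrite eqn_leq [(_ <= m)%N]leqNgt [(m <= _)%N]leqNgt.
  apply/andP; split; apply/negP => im.
    by move: xim; rewrite ltNge mono // -ltnS.
  by move: xmi; rewrite leNgt (design_points_lt hx).
rewrite -ltnS lm; congr (_ * _).
apply: eq_divdiff_points => j jl; rewrite -subSn //.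
case: ltnP => // lj; have -> : j = l by lia.
by rewrite subnK // ltnW.
Qed.

(** Raising the order by one adds one design point, on the left, to the window
    of the divided difference; so each order in turn settles one more value. *)
Lemma discrete_deriv_agree (R : realType) (k n : nat) (a b : R) (x : nat -> R)
    (m : nat) (f g : R -> R) :
  design_points n a b x -> (k <= m)%N -> (m <= n)%N ->
  (forall l, (l < k)%N ->
    discrete_deriv n x l f (x m) = discrete_deriv n x l g (x m)) <->
  (forall l, (l < k)%N -> f (x (m - l)%N) = g (x (m - l)%N)).
Proof.
move=> hx km mn; split=> fg l lk; last first.
  rewrite !(discrete_deriv_design _ hx) ?(leq_trans lk) //; congr (_ * _).
  apply: eq_divdiff => i il.
  have -> : (m - l + i = m - (l - i))%N by lia.
  by apply: fg; lia.
elim/ltn_ind: l lk => l IH lk.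
have lm : (l < m)%N by apply: leq_trans km.
have := fg l lk; rewrite !(discrete_deriv_design _ hx) //.
have fact0 : l`!%:R != 0 :> R by rewrite pnatr_eq0 -lt0n fact_gt0.
move/(mulfI fact0)/divdiff_head; rewrite addn0; apply=> i il.
  by rewrite gt_eqF // (design_points_lt hx) //; lia.
have -> : (m - l + i = m - (l - i))%N by lia.
by apply: IH; lia.
Qed.

(** * The falling factorial polynomials *)

(** The polynomial factor of the [j]th basis function. The bounds
    [maxn 1 (j - k)] and [minn j.-1 k] merge the two cases [j <= k + 1] and
    [j >= k + 2]: the factors are always the last [k] of
    ['X - x 1, ..., 'X - x (j - 1)], or all of them if there are fewer. *)
Definition ff_poly (R : realType) (k : nat) (x : nat -> R) (j : nat) : {poly R} :=
  (minn j.-1 k)`!%:R^-1 *: \prod_(maxn 1 (j - k) <= l < j) ('X - (x l)%:P).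

Lemma ff_basisE (R : realType) (k : nat) (a b : R) (x : nat -> R) (j : nat)
    (z : dom a b) : (1 <= j)%N ->
  ff_basis k x j z =
  (ff_poly k x j).[val z] * ((j <= k.+1)%N || (x j.-1 < val z))%:R.
Proof.
move=> j1; rewrite /ff_basis /ff_poly hornerZ horner_prod.
under [X in _ = _ * X * _]eq_bigr do rewrite hornerXsubC.
case: leqP => jk /=.
  have -> : minn j.-1 k = j.-1 by lia.
  have -> : maxn 1 (j - k) = 1%N by lia.
  by rewrite mulr1.
have -> : minn j.-1 k = k by lia.
by have -> : maxn 1 (j - k) = (j - k)%N by lia.
Qed.

Lemma size_ff_poly (R : realType) (k : nat) (x : nat -> R) (j : nat) :
  (1 <= j)%N -> size (ff_poly k x j) = (minn j.-1 k).+1.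
Proof.
move=> j1; rewrite size_scale ?invr_eq0 ?pnatr_eq0 -?lt0n ?fact_gt0 //.
rewrite size_prod_XsubC size_iota; lia.
Qed.

Lemma ff_poly_root (R : realType) (k : nat) (x : nat -> R) (m l : nat) :
  (k <= m)%N -> (l < k)%N -> (ff_poly k x m.+1).[x (m - l)%N] = 0.
Proof.
move=> km lk; apply/rootP; rewrite /ff_poly rootZ; last first.
  by rewrite invr_eq0 pnatr_eq0 -lt0n fact_gt0.
rewrite -(big_map x predT (fun c => 'X - c%:P)) root_prod_XsubC map_f //.
by rewrite mem_index_iota; lia.
Qed.

(** * Expansions in polynomials of given degrees *)

Lemma size_cancel_lead (R : realType) (p q : {poly R}) (N : nat) :
  size q = N.+1 -> (size p <= N.+1)%N ->
  (size (p - (p`_N / lead_coef q) *: q)%R <= N)%N.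
Proof.
move=> sq sp; apply/leq_sizeP => i; rewrite leq_eqVlt coefB coefZ => /orP[].
  have q0 : q != 0 by rewrite -size_poly_eq0 sq.
  by move/eqP <-; rewrite [q`_N]/(q`_N.+1.-1) -sq divfK ?subrr ?lead_coef_eq0.
move=> Ni; have pi0 : p`_i = 0 by rewrite nth_default // (leq_trans sp).
by rewrite pi0 [q`_i]nth_default ?sq // mulr0 subr0.
Qed.

Lemma poly_expansion (R : realType) (P : nat -> {poly R}) (N : nat) (p : {poly R}) :
  (forall j, (1 <= j <= N)%N -> size (P j) = j) -> (size p <= N)%N ->
  exists c : nat -> R, p = \sum_(1 <= j < N.+1) c j *: P j.
Proof.
elim: N p => [|N IH] p sP sp.
  exists (fun=> 0); rewrite big_geq //; apply/eqP.
  by rewrite -size_poly_eq0 -leqn0.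
set d := p`_N / lead_coef (P N.+1).
have [||c pE] := IH (p - d *: P N.+1).
- by move=> j /andP[j1 jN]; apply: sP; rewrite j1 leqW.
- by apply: size_cancel_lead => //; apply: sP; rewrite /= leqnn.
exists (fun j => if (j <= N)%N then c j else d).
rewrite big_nat_recr //= ltnn; apply/eqP; rewrite -subr_eq pE; apply/eqP.
by apply: eq_big_nat => j /andP[_ jN]; rewrite -ltnS jN.
Qed.

(** Cancelling the coefficient of degree [k] in [q] with [ff_poly k x m.+1]
    leaves a polynomial of degree less than [k] that keeps the [k] common
    roots, which are distinct as the design points increase: it is zero. *)
Lemma ff_poly_multiple (R : realType) (k : nat) (x : nat -> R) (m : nat)
    (q : {poly R}) :
  (k <= m)%N ->
  (forall i j, (1 <= i)%N -> (i < j)%N -> (j <= m)%N -> x i < x j) ->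
  (size q <= k.+1)%N -> (forall l, (l < k)%N -> q.[x (m - l)%N] = 0) ->
  exists d : R, q = d *: ff_poly k x m.+1.
Proof.
move=> km xlt sq q0; have sP : size (ff_poly k x m.+1) = k.+1.
  by rewrite size_ff_poly //= (minn_idPr km).
exists (q`_k / lead_coef (ff_poly k x m.+1)).
apply/eqP; rewrite -subr_eq0; apply/eqP.
apply: (@roots_geq_poly_eq0 _ _ [seq x (m - l)%N | l <- iota 0 k]).
- rewrite all_map; apply/allP => l; rewrite mem_iota /= => lk.
  by rewrite rootE hornerD hornerN hornerZ q0 // ff_poly_root // mulr0 subrr.
- rewrite map_inj_in_uniq ?iota_uniq // => i j; rewrite !mem_iota /= !add0n.
  have step i' j' : (i' < j')%N -> (j' < k)%N -> x (m - j')%N < x (m - i')%N.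
    move=> ij jk; have jm : (j' < m)%N by apply: leq_trans km.
    by rewrite xlt ?subn_gt0 ?leq_subr // ltn_sub2l // (ltn_trans ij).
  move=> ik jk /eqP; case: (ltngtP i j) => // ij.
    by rewrite gt_eqF // step.
  by rewrite lt_eqF // step.
- by rewrite size_map size_iota size_cancel_lead.
Qed.

(** In one direction, the term gained from [p i.-1] to [p i] vanishes at the
    matching points. In the other, the coefficients are recovered from the
    pieces: the first [k + 1] from [p 0], and the one of index [k + i + 1] from
    [p i - p i.-1]. *)
Lemma ff_partial_sums (R : realType) (k r : nat) (x : nat -> R)
    (p : nat -> {poly R}) :
  (forall i j, (1 <= i)%N -> (i < j)%N -> (j <= k + r)%N -> x i < x j) ->
  (exists c : nat -> R, forall i, (i <= r)%N ->
     p i = \sum_(1 <= j < (k + i).+2) c j *: ff_poly k x j) <->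
  (forall i, (i <= r)%N -> (size (p i) <= k.+1)%N) /\
  (forall i, (1 <= i <= r)%N -> forall l, (l < k)%N ->
     (p i.-1).[x (k + i - l)%N] = (p i).[x (k + i - l)%N]).
Proof.
move=> xlt; split=> [[c pE]|[]].
  split=> [i ir|[//|i] /andP[_ ir] l lk].
    rewrite pE // big_nat; elim/big_ind: _ => [|u v su sv|j /andP[j1 _]].
    - by rewrite size_poly0.
    - by rewrite (leq_trans (size_polyD _ _)) // geq_max su.
    - by rewrite (leq_trans (size_scale_leq _ _)) // size_ff_poly // ltnS geq_minr.
  rewrite /= !pE ?(ltnW ir) // addnS [in RHS]big_nat_recr //= hornerD hornerZ.
  by rewrite -addnS ff_poly_root ?leq_addr // mulr0 addr0.
elim: r xlt => [|r IH] xlt sp pp.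
  have [|//|c pE] := @poly_expansion _ (ff_poly k x) k.+1 (p 0%N).
  - move=> j /andP[j1 jk]; rewrite size_ff_poly // (minn_idPl _) ?prednK //.
    by rewrite -ltnS prednK.
  - exact: sp.
  by exists c => i; rewrite leqn0 => /eqP ->; rewrite addn0.
have [|i ir|i /andP[i1 ir] l|c pE] := IH.
- by move=> i j i1 ij jr; apply: xlt; rewrite // addnS leqW.
- exact/sp/leqW.
- by apply: pp; rewrite i1 leqW.
have [|||l lk|d dE] := @ff_poly_multiple _ k x (k + r.+1)%N (p r.+1 - p r).
- exact: leq_addr.
- exact: xlt.
- by rewrite (leq_trans (size_polyD _ _)) // geq_max size_polyN !sp.
- by rewrite hornerD hornerN -(pp r.+1) ?subrr //= leqnn.
exists (fun j => if (j <= (k + r).+1)%N then c j else d) => i.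
have cE i' : (i' <= r)%N -> p i' = \sum_(1 <= j < (k + i').+2)
    (if (j <= (k + r).+1)%N then c j else d) *: ff_poly k x j.
  move=> ir; rewrite pE //; apply: eq_big_nat => j /andP[_]; rewrite ltnS => ji.
  by rewrite (leq_trans ji) // ltnS leq_add2l.
rewrite leq_eqVlt => /orP[/eqP ->|]; last by rewrite ltnS => /cE.
rewrite big_nat_recr //= [X in \sum_(1 <= j < X.+1) _]addnS -cE //.
by rewrite addnS ltnn -addnS -dE addrC subrK.
Qed.

(** * The basis functions between two consecutive knots *)

Lemma knot_interval_cover (R : realType) (a b : R) (r : nat) (t : nat -> R)
    (z : dom a b) :
  exists2 i, (i <= r)%N & val z \in knot_interval a b r t i.
Proof.
have /andP[az zb] : a <= val z <= b by have := valP z; rewrite in_itv.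
have hr : exists i, val z <= knot a b r t i.+1.
  by exists r; rewrite /knot /= eqxx.
(* The first knot that is at least z is the right end of its interval. *)
case: (ex_minnP hr) => i zi imin; exists i.
  by apply: imin; rewrite /knot /= eqxx.
rewrite /knot_interval; case: i zi imin => [|i] zi imin /=.
  by rewrite in_itv /= zi andbT.
by rewrite in_itv /= zi andbT ltNge; apply/negP => /imin; rewrite ltnn.
Qed.

(** For [j >= k + 2] the indicator switches on at [x j.-1], which is the knot
    of index [j - k - 1]; on the [i]th interval it is on when that index is at
    most [i]. *)
Lemma ff_basis_piece (R : realType) (k n : nat) (a b : R) (x : nat -> R)
    (i j : nat) (z : dom a b) :
  (k.+1 <= n)%N -> design_points n a b x -> (i <= n - k.+1)%N ->
  val z \in knot_interval a b (n - k.+1) (fun i => x (k + i)%N) i ->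
  (1 <= j <= n)%N ->
  ff_basis k x j z =
  if (j <= (k + i).+1)%N then (ff_poly k x j).[val z] else 0.
Proof.
move=> hn hx ir zi /andP[j1 jn].
have mono := design_points_mono hx.
rewrite ff_basisE //; set c := (_ || _).
suff -> : c = (j <= (k + i).+1)%N by case: ifP; rewrite ?mulr1 ?mulr0.
rewrite {}/c; case: leqP => jk /=.
  by rewrite (leq_trans jk) // ltnS leq_addr.
case: j j1 jn jk => // j _ jn jk; rewrite ltnS /=.
have zhi : val z <= knot a b (n - k.+1) (fun i => x (k + i)%N) i.+1.
  by move: zi; rewrite /knot_interval; case: eqP => [->|_]; rewrite in_itv => /andP[].
case: leqP => [ji|ij].
  have i0 : (0 < i)%N by rewrite -(ltn_add2l k) addn0 (leq_trans _ ji).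
  move: zi; rewrite /knot_interval (gtn_eqF i0) in_itv => /andP[zlo _].
  apply: le_lt_trans zlo; rewrite /knot (gtn_eqF i0) (ltn_eqF (_ : i < _)%N) ?ltnS //.
  by apply: mono; lia.
apply/negbTE; rewrite -leNgt (le_trans zhi) //.
rewrite /knot /= ltn_eqF; last by lia.
by apply: mono; lia.
Qed.

Lemma ff_sum_piece (R : realType) (k n : nat) (a b : R) (x : nat -> R)
    (c : nat -> R) (i : nat) (z : dom a b) :
  (k.+1 <= n)%N -> design_points n a b x -> (i <= n - k.+1)%N ->
  val z \in knot_interval a b (n - k.+1) (fun i => x (k + i)%N) i ->
  (\sum_(1 <= j < n.+1) c j *: (ff_basis k x j : dom a b -> R^o)) z =
  (\sum_(1 <= j < (k + i).+2) c j *: ff_poly k x j).[val z].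
Proof.
move=> hn hx ir zi; have kin : ((k + i).+2 <= n.+1)%N.
  by rewrite ltnS -(subnKC hn) addSn ltnS leq_add2l.
rewrite horner_sum (big_nat_widen _ _ _ _ _ kin) [RHS]big_mkcond fct_sumE /=.
apply: eq_big_nat => j /andP[j1 jn]; rewrite hornerZ.
rewrite /GRing.scale /= (ff_basis_piece hn hx ir zi) ?j1 // ltnS.
by case: ifP => _ //; rewrite scaler0.
Qed.

Theorem lemma3 (R : realType) (k n : nat) (a b : R) (x : nat -> R)
    (hn : (k.+1 <= n)%N) (hx : design_points n a b x) :
  falling_factorial_space k n a b x =
  discrete_splines k n a b x (n - k.+1)%N (fun i => x (k + i)%N).
Proof.
have kr i : (i <= n - k.+1 -> k + i <= n)%N.
  by move=> ir; rewrite -(subnKC hn) leq_add.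
have sums p := @ff_partial_sums R k (n - k.+1) x p
  (fun i j i1 ij jr => design_points_lt hx i1 ij (leq_trans jr (kr _ (leqnn _)))).
apply/seteqP; split=> f.
  case=> c ->; pose p i := \sum_(1 <= j < (k + i).+2) c j *: ff_poly k x j.
  have [|sp pp] := (sums p).1; first by exists c.
  exists p; split=> // [i ir z zi|i /andP[i1 ir]]; first exact: ff_sum_piece.
  apply/(discrete_deriv_agree _ _ hx); rewrite ?leq_addr ?kr //.
  by apply: pp; rewrite i1.
case=> p [sp fp pp]; have [|c pE] := (sums p).2.
  split=> // i /andP[i1 ir].
  apply/(discrete_deriv_agree _ _ hx); rewrite ?leq_addr ?kr //.
  by apply: pp; rewrite i1.
exists c; apply/funext => z.
have [i ir zi] := knot_interval_cover (n - k.+1) (fun i => x (k + i)%N) z.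
by rewrite (ff_sum_piece _ hn hx ir zi) -pE //; apply: fp.
Qed.
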